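(* Let $X$ be an analytic metric space. For each $\delta>0$ there is a Lipschitz-ultrametric compact set $S\subseteq X$ such that $\dim_{\mathsf P} S\geq\dim_{\mathsf P} X-\delta$.
   Context: All spaces under consideration are separable metric spaces. A metric space is analytic if it is a continuous image of a complete metric space (equivalently, of the irrational numbers). $B(x,r)$ denotes the closed ball with center $x$ and radius $r$. A metric space $(U,d)$ is ultrametric if $d(x,z)\le\max\{d(x,y),d(y,z)\}$ for all $x,y,z\in U$. A metric space $S$ is called Lipschitz-ultrametric if there is a Lipschitz bijection $f:S\to U$ onto an ultrametric space $U$. Packing measure. Let $E$ be a subset of a metric space $X$. A family of balls $\{B(x_i,r_i):i\in I\}$ is a packing of $E$ if $x_i\in E$ for all $i$ and $x_j\notin B(x_i,r_i)$ whenever $i\neq j$. For $\delta>0$, the packing is $\delta$-fine if $r_i\le\delta$ for all $i$. For $s>0$ let $\mathcal P^s_\delta(E)=\sup\{\sum_{i\in I}r_i^s:\{B(x_i,r_i):i\in I\}\text{ is a }\delta\text{-fine packing of }E\}$, $\mathcal P^s_0(E)=\inf_{\delta>0}\mathcal P^s_\delta(E)$, and $\mathcal P^s(E)=\inf\sum_n\mathcal P^s_0(E_n)$, where the infimum is taken over all countable covers $\{E_n\}$ of $E$. The packing dimension of $E$ is $\dim_{\mathsf P}E=\inf\{s>0:\mathcal P^s(E)=0\}=\sup\{s>0:\mathcal P^s(E)=\infty\}$.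
   Formalization: When dim_P X is infinite, the bound dim_P S ≥ dim_P X − δ is replaced by: for every real M there is such an S with dim_P S ≥ M (read literally it fails, e.g. for the disjoint union of the cubes [0,1]^n at mutual distance 1). *)

(* Defs.v *)
From HB Require Import structures.
From mathcomp Require Import all_boot all_order all_algebra.
From mathcomp Require Import all_classical all_reals all_analysis.

Set Implicit Arguments.
Unset Strict Implicit.
Unset Printing Implicit Defensive.

Import Order.TTheory GRing.Theory Num.Theory.
Import numFieldNormedType.Exports.

Local Open Scope classical_set_scope.
Local Open Scope ring_scope.

Definition separable (T : topologicalType) : Prop :=
  exists2 D : set T, countable D & dense D.

(* The library's bundled complete pseudometric spaces are pointed; the filter
   property is used directly so that the empty space is not excluded. *)
Definition complete_space (T : uniformType) : Prop :=
  forall F : set_system T, ProperFilter F -> cauchy F -> exists x : T, F --> x.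

(* Separability of Y is the standing assumption on all spaces and cannot be
   dropped: every metric space is a continuous image of a discrete one.
   Separability of X follows. *)
Definition analytic (R : realType) (X : metricType R) : Prop :=
  exists (Y : metricType R) (f : Y -> X),
    [/\ separable Y, complete_space Y, continuous f & set_surj setT setT f].

Definition ultrametric (R : realType) (U : metricType R) : Prop :=
  forall x y z : U, mdist x z <= Num.max (mdist x y) (mdist y z).

(* A subset S of X carries the metric of X restricted to the points of the
   subtype [set_type S]. *)
Definition lipschitz_ultrametric (R : realType) (X : metricType R)
    (S : set X) : Prop :=
  exists (U : metricType R) (f : set_type S -> U),
    [/\ ultrametric U, bijective f
      & exists L : R, forall x y : set_type S,
          mdist (f x) (f y) <= L * mdist (val x) (val y)].

(* Not the library's [closed_ball], which is the closure of the open ball and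
   may be smaller. *)
Definition cball (R : realType) (X : metricType R) (x : X) (r : R) : set X :=
  [set y | mdist x y <= r].

Section packing.
Context {R : realType} {X : metricType R}.
Implicit Types (E : set X) (s delta : R).

Definition is_packing (I : Type) (x : I -> X) (r : I -> R) E : Prop :=
  [/\ forall i, E (x i),
      forall i, 0 < r i
    & forall i j, i <> j -> ~ cball (x i) (r i) (x j)].

Definition packing_pre_delta s delta E : \bar R :=
  ereal_sup [set t | exists (I : choiceType) (x : I -> X) (r : I -> R),
    [/\ is_packing x r E, forall i, r i <= delta
      & t = (\esum_(i in [set: I]) (r i `^ s)%:E)%E]].

Definition packing_premeasure s E : \bar R :=
  ereal_inf [set packing_pre_delta s delta E | delta in [set delta | 0 < delta]].

Definition packing_measure s E : \bar R :=
  ereal_inf [set t | exists2 F : nat -> set X, E `<=` \bigcup_n F n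
    & t = (\sum_(0 <= n <oo) packing_premeasure s (F n))%E].

Definition packing_dim E : \bar R :=
  ereal_inf [set s%:E | s in [set s | 0 < s /\ packing_measure s E = 0%E]].

End packing.

(* Main.v *)
Require Import Defs.
From HB Require Import structures.
From mathcomp Require Import all_boot all_order all_algebra.
From mathcomp Require Import all_classical all_reals all_analysis.
From mathcomp Require Import finmap lra.

Set Implicit Arguments.
Unset Strict Implicit.
Unset Printing Implicit Defensive.

Import Order.TTheory GRing.Theory Num.Theory.

Local Open Scope classical_set_scope.
Local Open Scope ring_scope.

(** The idea.  Let 0 < s < t < dim X and let [f : Y -> X] be a continuous
    surjection from a complete separable metric space.

    Say that a subset of X is sigma-null when it is covered by countably many
    sets whose packing premeasure of exponent t vanishes.  These sets form a
    sigma-ideal, and X is not among them because t < dim X.  Discarding from Y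
    the countably many basic balls with sigma-null image leaves the fat points
    of Y: the fat points in any ball around a fat point have an image of
    positive t-premeasure ([fat_points_near]).  Since s < t, such an image
    carries, for every delta, a finite delta-fine packing with
    [\sum r ^ s >= 1] ([packing_premeasure_gt0_full]).

    Starting from one fat point, build an increasing sequence of finite
    sets of fat points: stage n + 1 adds, very close to each point of stage n, the
    centres of such a packing with delta = 1 / (n + 1) ([net_extend]).  The
    closure K of the union of the stages is totally bounded, hence compact,
    and S is [f @` K].

    - S is Lipschitz-ultrametric.  At each stage, the images of the net points
      form a net of S whose mesh is small compared with the distances between
      distinct images, so S splits into pieces at positive distance from
      each other.  Distinct points of S are therefore not joined by chains
      of arbitrarily small steps, and the least possible step size is an
      ultrametric bounded by the distance
      ([finite_nets_lipschitz_ultrametric]).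

    - dim S >= s.  If countably many sets F n cover S, by Baire's theorem
      ([compact_baire]) the preimage of some F n is dense in a nonempty
      relatively open part of K.  This part contains the centres of the
      packings attached to a net point at all late stages.  They are finite
      and the condition [mdist x y > r] is open, so the images of the centres
      can be moved into F n with the radii kept ([full_packing_perturb]): the
      premeasure of F n is at least 1 for every exponent up to s. *)

(** * The subdominant ultrametric *)

Section subdominant_ultrametric.
Context {R : realType} {X : metricType R} (S : set X).
Implicit Types (x y z : set_type S) (e : R).

(** The existence of a chain from x to y with steps shorter than e, encoded
    through invariant sets rather than sequences of points: composing chains
    is then immediate. *)
Definition chained e x y : Prop :=
  forall C : set (set_type S),
    (forall u v, C u -> mdist (val u) (val v) < e -> C v) -> C x -> C y.

Lemma chained_step e x y : mdist (val x) (val y) < e -> chained e x y.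
Proof. by move=> xy C Cstep /Cstep; apply. Qed.

Lemma chained_refl e x : chained e x x.
Proof. by []. Qed.

Lemma chained_trans e x y z : chained e x y -> chained e y z -> chained e x z.
Proof. by move=> xy yz C Cstep Cx; apply: yz => //; exact: xy. Qed.

(** The points from which x is reachable form a set invariant under steps,
    because steps are symmetric. *)
Lemma chained_sym e x y : chained e x y -> chained e y x.
Proof.
move=> /(_ [set z | chained e z x]); apply; last exact: chained_refl.
move=> u v ux uv; apply: chained_trans ux; apply: chained_step.
by rewrite metric_sym.
Qed.

Lemma chained_le e e' x y : e <= e' -> chained e x y -> chained e' x y.
Proof.
move=> ee' xy C Cstep; apply: xy => u v Cu uv; apply: Cstep Cu _.
exact: lt_le_trans ee'.
Qed.

Definition chain_dist x y : R := inf [set e | 0 < e /\ chained e x y].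

Let chain_has_inf x y : has_inf [set e | 0 < e /\ chained e x y].
Proof.
split; last by exists 0 => e [/ltW].
exists (mdist (val x) (val y) + 1); split; first exact: ltr_wpDl (mdist_ge0 _ _) _.
by apply: chained_step; rewrite ltrDl.
Qed.

Lemma chain_dist_le e x y : 0 < e -> chained e x y -> chain_dist x y <= e.
Proof. by move=> e0 xy; apply: ge_inf; [case: (chain_has_inf x y)|]. Qed.

Lemma chain_dist_ge0 x y : 0 <= chain_dist x y.
Proof. by apply: lb_le_inf; [case: (chain_has_inf x y)|move=> e [/ltW]]. Qed.

Lemma chained_lt e x y : chain_dist x y < e -> chained e x y.
Proof.
move=> xye; have [e' [_ xy] /ltW lee] := inf_lt (chain_has_inf x y).1 xye.
exact: chained_le xy.
Qed.

Lemma chain_distxx x : chain_dist x x = 0.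
Proof.
apply/eqP; rewrite eq_le chain_dist_ge0 andbT.
by apply/ler_addgt0Pl => e e0; rewrite addr0; exact: chain_dist_le.
Qed.

Lemma chain_distC x y : chain_dist x y = chain_dist y x.
Proof.
by congr inf; apply/seteqP; split => e [e0 xy]; split=> //; exact: chained_sym.
Qed.

Lemma chain_dist_max y x z :
  chain_dist x z <= Num.max (chain_dist x y) (chain_dist y z).
Proof.
apply/ler_addgt0Pr => e e0; apply: chain_dist_le.
  by apply: ltr_wpDl => //; rewrite le_max chain_dist_ge0.
apply: (@chained_trans _ _ y); apply: chained_lt; rewrite ltr_pwDr//.
  by rewrite le_max lexx.
by rewrite le_max lexx orbT.
Qed.

Lemma chain_distD y x z : chain_dist x z <= chain_dist x y + chain_dist y z.
Proof.
apply: (le_trans (chain_dist_max y x z)).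
by rewrite ge_max lerDl lerDr !chain_dist_ge0.
Qed.

Lemma chain_dist_le_mdist x y : chain_dist x y <= mdist (val x) (val y).
Proof.
apply/ler_addgt0Pr => e e0; apply: chain_dist_le.
  exact: ltr_wpDl (mdist_ge0 _ _) _.
by apply: chained_step; rewrite ltrDl.
Qed.

Definition chain_separated : Prop := forall x y, chain_dist x y = 0 -> x = y.

(** The carrier depends on the separation hypothesis so that the metric
    structure can be attached to the type itself. *)
Definition chain_space (_ : chain_separated) : Type := set_type S.

HB.instance Definition _ (sepS : chain_separated) :=
  Choice.on (chain_space sepS).

HB.instance Definition _ (sepS : chain_separated) :=
  @isMetric.Build R (chain_space sepS) chain_dist chain_distxx
    sepS chain_distC chain_distD.

(** The identity is 1-Lipschitz because a single step is a chain. *)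
Lemma chain_separated_lipschitz_ultrametric :
  chain_separated -> lipschitz_ultrametric S.
Proof.
move=> sepS; exists (chain_space sepS), id; split.
- by move=> x y z; exact: chain_dist_max.
- by exists id.
- by exists 1 => x y; rewrite mul1r; exact: chain_dist_le_mdist.
Qed.

End subdominant_ultrametric.

Lemma lipschitz_ultrametric0 (R : realType) (X : metricType R) :
  lipschitz_ultrametric (@set0 X).
Proof.
by apply: chain_separated_lipschitz_ultrametric => x; case: (set_valP x).
Qed.

(** The traces on S of the balls [mdist p x <= d], p in F, are at distance at
    least 2 d from each other, so a chain of steps shorter than 2 d never
    leaves the ball in which it starts, and its ends are 2 d-close. *)
Lemma finite_nets_lipschitz_ultrametric (R : realType) (X : metricType R)
    (S : set X) :
  (forall e : R, 0 < e -> exists (F : set X) (d : R), [/\ 0 < d, d <= e,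
     forall p q, F p -> F q -> p != q -> 4 * d < mdist p q &
     forall x, S x -> exists2 p, F p & mdist p x <= d]) ->
  lipschitz_ultrametric S.
Proof.
move=> nets; apply: chain_separated_lipschitz_ultrametric => x y xy0.
apply: val_inj; apply: mdist_positivity; apply/eqP.
rewrite eq_le mdist_ge0 andbT; apply/ler_addgt0Pl => e e0; rewrite addr0.
have [F [d [d0 de Fsep Fnet]]] := nets (e / 2) (divr_gt0 e0 (ltr0Sn R 1)).
have dle (u v w : X) : mdist u w <= mdist u v + mdist v w.
  exact: metric_triangle.
have [p Fp px] := Fnet _ (set_valP x).
have xy : chained (2 * d) x y by apply: chained_lt; rewrite xy0 mulr_gt0.
suff py : mdist p (val y) <= d.
  by have := dle (val x) p (val y); rewrite (metric_sym _ p); lra.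
move: xy => /(_ [set z | mdist p (val z) <= d]); apply => // u v /= pu uv.
have [q Fq qv] := Fnet _ (set_valP v).
have [<-//|/Fsep pq] := eqVneq q p.
have := pq Fq Fp; have := dle q (val v) p; have := dle (val v) (val u) p.
by rewrite (metric_sym (val v) (val u)) (metric_sym (val u) p); lra.
Qed.

(** * Finite packings and the packing premeasure *)

Section packing_facts.
Context {R : realType} {X : metricType R}.
Implicit Types (E : set X) (s t delta : R).

(** Finite fine packings of s-mass at least 1 are the only witnesses of large
    packing dimension used below; finiteness is what makes them stable under
    small displacements of the centres. *)
Definition full_packing s delta E (I : finType) (x : I -> X) (r : I -> R) :=
  [/\ is_packing x r E, forall i, r i <= delta & 1 <= \sum_i r i `^ s].

Lemma packing_pre_delta_ge0 s delta E : (0 <= packing_pre_delta s delta E)%E.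
Proof.
apply: ereal_sup_ubound; exists void, (@of_void X), (@of_void R); split.
- by split; case.
- by case.
- by rewrite esum1//; case.
Qed.

Lemma packing_premeasure_ge0 s E : (0 <= packing_premeasure s E)%E.
Proof.
by apply/ereal_infP => _ [delta _ <-]; exact: packing_pre_delta_ge0.
Qed.

Lemma full_packing_pre_delta s delta E (I : finType) (x : I -> X) r :
  full_packing s delta E x r -> (1 <= packing_pre_delta s delta E)%E.
Proof.
move=> [pack rdelta ge1].
apply: le_trans (_ : (\sum_i r i `^ s)%:E <= _)%E; first by rewrite lee_fin.
apply: ereal_sup_ubound; exists I, x, r; split => //.
rewrite esum_fset; [|exact: finite_finset|]; last by move=> i _; rewrite lee_fin powR_ge0.
rewrite -sumEFin -big_enum/= [setT](_ : _ = [set` enum I]).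
  by rewrite fsbig_seq// enum_uniq.
by apply/seteqP; split => i //= _; rewrite mem_enum.
Qed.

(** Radii at most 1 have larger powers for smaller exponents. *)
Lemma full_packing_exponent s s' delta E (I : finType) (x : I -> X) r :
  delta <= 1 -> s' <= s -> full_packing s delta E x r ->
  full_packing s' delta E x r.
Proof.
move=> delta1 ss' [pack rdelta ge1]; split=> //; apply: (le_trans ge1).
apply: ler_sum => i _; apply: ger_powR => //.
by case: pack => _ -> _ /=; exact: le_trans delta1.
Qed.

(** Radii [r <= eta] satisfy [r ^ t <= r ^ s * eta ^ (t - s)], so a packing
    of t-mass at least c has s-mass at least [c * eta ^ (s - t)], and this is
    at least 1 for small eta. *)
Lemma packing_premeasure_gt0_full s t delta E : s < t -> 0 < delta ->
  (0 < packing_premeasure t E)%E ->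
  exists (I : finType) (x : I -> X) r, full_packing s delta E x r.
Proof.
move=> st delta0 E0.
have [c c0 cE] : exists2 c : R, 0 < c & (c%:E < packing_premeasure t E)%E.
  move: E0; case: (packing_premeasure t E) => [a| |]//=.
    rewrite lte_fin => a0; exists (a / 2); first by rewrite divr_gt0.
    by rewrite lte_fin; lra.
  by move=> _; exists 1; rewrite ?ltry.
(* the second bound makes [eta ^ (t - s) <= c] *)
pose eta := Num.min delta (c `^ (t - s)^-1).
have eta0 : 0 < eta by rewrite lt_min delta0 powR_gt0.
have etac : eta `^ (t - s) <= c.
  apply: (@le_trans _ _ ((c `^ (t - s)^-1) `^ (t - s))).
    apply: ge0_ler_powR; rewrite ?nnegrE ?(ltW eta0) ?powR_ge0//.
      by rewrite subr_ge0 ltW.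
    by rewrite ge_min lexx orbT.
  by rewrite -powRrM mulVf ?powRr1// ?ltW// subr_eq0 gt_eqF.
have : (c%:E < packing_pre_delta t eta E)%E.
  by apply: lt_le_trans cE _; apply: ereal_inf_lbound; exists eta.
move=> /ereal_sup_gt[_ [I [x [r [[xE r0 sep] reta ->]]]]].
move=> /ereal_sup_gt[_ [A [finA _] <-]].
rewrite fsbig_finite//= sumEFin lte_fin big_seq_fsetE /= => cA.
exists (fset_set A), (x \o val), (r \o val); split.
- split=> [i|i|i j ij]; [exact: xE|exact: r0|].
  by apply: sep => /val_inj.
- by move=> i; rewrite (le_trans (reta _))// ge_min lexx.
- rewrite -(ler_pM2r c0) mul1r mulr_suml; apply: (le_trans (ltW cA)).
  apply: ler_sum => i _ /=; rewrite -[t in X in X <= _](subrKC s).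
  rewrite powRD; last by rewrite (gt_eqF (r0 _)) implybT.
  rewrite ler_wpM2l ?powR_ge0//; apply: le_trans etac.
  by apply: ge0_ler_powR; rewrite ?nnegrE ?subr_ge0 ?(ltW eta0) ?(ltW (r0 _)) ?(ltW st).
Qed.

End packing_facts.

(** Serves to choose one radius for all points of a stage of the construction,
    and one displacement for all pairs of centres of a packing. *)
Lemma uniform_radius (R : realType) (T : eqType) (l : seq T)
    (P : T -> R -> Prop) :
  (forall a, a \in l ->
     exists2 e, 0 < e & forall e', 0 < e' -> e' <= e -> P a e') ->
  exists2 e, 0 < e & forall a e', a \in l -> 0 < e' -> e' <= e -> P a e'.
Proof.
elim: l => [|a l IHl] Pl; first by exists 1.
have [e1 e10 Pe1] := Pl a (mem_head _ _).
have [b bl|e2 e20 Pe2] := IHl; first by apply: Pl; rewrite inE bl orbT.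
exists (Num.min e1 e2); first by rewrite lt_min e10.
move=> b e' /[!inE] /orP[/eqP ->|bl] e'0; rewrite le_min => /andP[le1 le2].
  exact: Pe1.
exact: Pe2.
Qed.

(** * Lower bounds for the packing dimension, and sigma-null sets *)

Section premeasure_and_dimension.
Context {R : realType} {X : metricType R}.
Implicit Types (E : set X) (s t delta : R).

(** The separation [r i < mdist (x i) (x j)] is a finite system of strict
    inequalities, so it survives a small displacement of the centres. *)
Lemma full_packing_perturb s delta E F (I : finType) (x : I -> X) r :
  full_packing s delta E x r ->
  (forall i e, 0 < e -> exists2 y, F y & mdist (x i) y < e) ->
  exists x' : I -> X, full_packing s delta F x' r.
Proof.
move=> [[_ r0 sep] rdelta ge1] xF.
have [e e0 Pe] : exists2 e, 0 < e & forall p e', p \in enum {: I * I} ->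
    0 < e' -> e' <= e -> p.1 <> p.2 -> r p.1 + 2 * e' < mdist (x p.1) (x p.2).
  apply: uniform_radius => -[i j] _ /=.
  have [<-|/eqP ij] := eqVneq i j; first by exists 1.
  have /negP := sep _ _ ij; rewrite /cball/= -ltNge => rij.
  exists ((mdist (x i) (x j) - r i) / 4); first by rewrite divr_gt0// subr_gt0.
  by move=> e' e'0 e'le _; lra.
have /choice[x' x'F] : forall i, exists y, F y /\ mdist (x i) y < e.
  by move=> i; have [y Fy xy] := xF i e e0; exists y.
exists x'; split=> //; split=> [i|//|i j ij]; first by have [] := x'F i.
rewrite /cball/=; apply/negP; rewrite -ltNge.
have := Pe (i, j) e (mem_enum _ _) e0 (lexx _) ij => /=.
have [_ xi] := x'F i; have [_ xj] := x'F j.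
have := metric_triangle (x i) (x' i) (x j).
have := metric_triangle (x' i) (x' j) (x j).
by rewrite (metric_sym (x' j)); lra.
Qed.

Definition everywhere_full s E := forall delta, 0 < delta ->
  exists (I : finType) (x : I -> X) r, full_packing s delta E x r.

Lemma everywhere_full_premeasure s s' E : s' <= s ->
  everywhere_full s E -> (1 <= packing_premeasure s' E)%E.
Proof.
move=> ss' fullE; apply/ereal_infP => _ [delta /= delta0 <-].
have [] := fullE (Num.min delta 1); first by rewrite lt_min delta0 ltr01.
move=> I [x [r /(full_packing_exponent _ ss')]].
move=> /(_ (ltac:(by rewrite ge_min lexx orbT)))[pack rle ge1].
apply: (@full_packing_pre_delta _ _ s' _ _ I x r); split => // i.
by rewrite (le_trans (rle i))// ge_min lexx.
Qed.

(** For s' < s the term of index n alone gives every cover an s'-sum at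
    least 1, so [packing_measure s' E] does not vanish. *)
Lemma packing_dim_ge s E :
  (forall F : nat -> set X, E `<=` \bigcup_n F n ->
     exists n, everywhere_full s (F n)) ->
  (s%:E <= packing_dim E)%E.
Proof.
move=> covers; apply/ereal_infP => _ [s' [s'0 Pnull] <-].
rewrite lee_fin leNgt; apply/negP => s's.
suff : (1 <= packing_measure s' E)%E by rewrite Pnull lee_fin ler10.
apply/ereal_infP => _ [F EF ->].
have [n Fn] := covers F EF.
apply: (le_trans (everywhere_full_premeasure (ltW s's) Fn)).
have F0 k : (0 <= packing_premeasure s' (F k))%E.
  exact: packing_premeasure_ge0.
by rewrite (@nneseriesD1 _ _ n)// leeDl// nneseries_ge0.
Qed.

Lemma packing_dim_ge0 E : (0 <= packing_dim E)%E.
Proof. by apply/ereal_infP => _ [s [/ltW s0 _] <-]; rewrite lee_fin. Qed.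

(** A sigma-ideal contained in the null sets of the packing measure.  Asking
    each piece to have premeasure exactly 0, instead of a small sum over a
    cover, spares all estimates with double series. *)
Definition premeasure_sigma_null t E := exists2 F : nat -> set X,
  E `<=` \bigcup_n F n & forall n, packing_premeasure t (F n) = 0%E.

Lemma premeasure_sigma_nullS t E E' : E `<=` E' ->
  premeasure_sigma_null t E' -> premeasure_sigma_null t E.
Proof. by move=> EE' [F E'F F0]; exists F => //; exact: subset_trans E'F. Qed.

Lemma packing_premeasure_set0 t : packing_premeasure t (@set0 X) = 0%E.
Proof.
apply/eqP; rewrite eq_le packing_premeasure_ge0 andbT.
apply: (@le_trans _ _ (packing_pre_delta t 1 set0)).
  by apply: ereal_inf_lbound; exists 1 => //=.
apply: ge_ereal_sup => _ [I [x [r [[x0 _ _] _ ->]]]].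
by rewrite esum1// => i; case: (x0 i).
Qed.

Lemma premeasure_sigma_null_bigcup t (I : Type) (D : set I) (E : I -> set X) :
  countable D -> (forall i, D i -> premeasure_sigma_null t (E i)) ->
  premeasure_sigma_null t (\bigcup_(i in D) E i).
Proof.
(* g codes D in nat; indices outside the image of g get empty pieces *)
move=> /countable_injP[g ginj] Enull.
have null_cover a : exists F : nat -> set X,
    (forall i, D i -> g i = a -> E i `<=` \bigcup_n F n) /\
    (forall n, packing_premeasure t (F n) = 0%E).
  have [[i [Di <-]]|noi] := pselect (exists i, D i /\ g i = a).
    have [F EF F0] := Enull i Di; exists F; split=> // j Dj ji.
    by rewrite (ginj _ _ (mem_set Dj) (mem_set Di) ji).
  exists (fun=> set0); split=> [i Di gi|n]; last exact: packing_premeasure_set0.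
  by exfalso; apply: noi; exists i.
have [F FP] := choice null_cover.
exists (fun n => if @choice.unpickle (nat * nat)%type n is Some (a, b) then F a b else set0).
  move=> x [i Di] /((FP (g i)).1 i Di erefl)[b _ Fx].
  by exists (choice.pickle (g i, b)) => //; rewrite choice.pickleK.
move=> n; case: choice.unpickle => [[a b]|]; last exact: packing_premeasure_set0.
by have [_ ->] := FP a.
Qed.

Lemma premeasure_sigma_null_dim t E : 0 < t ->
  premeasure_sigma_null t E -> (packing_dim E <= t%:E)%E.
Proof.
move=> t0 [F EF F0]; apply: ereal_inf_lbound; exists t => //; split => //.
apply/eqP; rewrite eq_le; apply/andP; split.
  by apply: ereal_inf_lbound; exists F => //; rewrite eseries0.
apply/ereal_infP => _ [G _ ->]; apply: nneseries_ge0 => n _ _.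
exact: packing_premeasure_ge0.
Qed.

Lemma premeasure_gt0 t E : ~ premeasure_sigma_null t E ->
  (0 < packing_premeasure t E)%E.
Proof.
move=> Enull; rewrite lt_def packing_premeasure_ge0 andbT; apply/eqP => E0.
by apply: Enull; exists (fun=> E) => // x Ex; exists 0.
Qed.

End premeasure_and_dimension.

(** * Compactness and category in metric spaces *)

Lemma indexed_dependent_choice (T : Type) (Inv : nat -> T -> Prop)
    (Rel : nat -> T -> T -> Prop) (x0 : T) :
  Inv 0 x0 ->
  (forall n x, Inv n x -> exists2 y, Inv n.+1 y & Rel n x y) ->
  exists x : nat -> T, forall n, Inv n (x n) /\ Rel n (x n) (x n.+1).
Proof.
move=> Inv0 step.
have /choice[next nextP] : forall p : nat * T, exists y,
    Inv p.1 p.2 -> Inv p.1.+1 y /\ Rel p.1 p.2 y.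
  move=> [n x] /=; have [/step[y]|noInv] := pselect (Inv n x); last by exists x.
  by exists y.
pose x := fix x n := if n is m.+1 then next (m, x m) else x0.
have Invx n : Inv n (x n).
  by elim: n => // n IHn; have [] := nextP (n, x n) IHn.
by exists x => n; split=> //; have [] := nextP (n, x n) (Invx n).
Qed.

Section metric_topology.
Context {R : realType} {Y : metricType R}.
Implicit Types (K G : set Y) (u v w : Y) (e r : R).

Lemma nbhs_mball u e : 0 < e -> nbhs u [set v | mdist u v < e].
Proof. by move=> e0; rewrite -ballEmdist; exact: nbhsx_ballx. Qed.

Lemma closure_mdist K u : closure K u <->
  (forall e, 0 < e -> exists2 v, K v & mdist u v < e).
Proof.
split=> [clK e e0|clK B].
  by have [v [Kv uv]] := clK _ (nbhs_mball u e0); exists v.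
rewrite -metricType_numDomainType.filter_from_mdist_nbhs => -[e /= e0 eB].
by have [v Kv uv] := clK e e0; exists v; split=> //; exact: eB.
Qed.

Lemma ultra_seq_cover (T : Type) (I : eqType) (F : set_system T)
    (A : I -> set T) (l : seq I) :
  UltraFilter F -> F [set u | exists2 a, a \in l & A a u] ->
  exists2 a, a \in l & F (A a).
Proof.
move=> FU; elim: l => [|a l IHl] FA.
  by have /filter_ex[u []] := FA.
have [Fa|Fa] := in_ultra_setVsetC (A a) FU.
  by exists a; rewrite ?mem_head.
have [|b bl Fb] := IHl; last by exists b => //; rewrite inE bl orbT.
apply: filterS (filterI FA Fa) => u [[b /[!inE] /orP[/eqP ->|bl] Abu] //= nAa].
by exists b.
Qed.

(** An ultrafilter on K contains a ball of each radius, hence is Cauchy. *)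
Lemma totally_bounded_compact K : complete_space Y -> closed K ->
  (forall e, 0 < e -> exists l : seq Y, forall u, K u ->
     exists2 a, a \in l & mdist a u <= e) ->
  compact K.
Proof.
move=> complY clK nets; rewrite compact_ultra => F FU FK.
have /complY[x Fx] : cauchy F.
  apply: cauchy_exP => e e0.
  have [l lK] := nets (e / 2) (divr_gt0 e0 (ltr0Sn R 1)).
  have [a _ Fa] : exists2 a, a \in l & F [set u | mdist a u <= e / 2].
    by apply: ultra_seq_cover; apply: filterS FK => u /lK.
  exists a; rewrite ballEmdist; apply: filterS Fa => u /=; lra.
exists x; split=> //; apply: clK => B /Fx FB.
exact: filter_ex (filterI FK FB).
Qed.

(** Baire's theorem on K: otherwise there is a decreasing sequence of closed
    balls centred in K, the (n + 1)-st missing the points of G n in K, and a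
    cluster point of the centres lies in all of these balls. *)
Lemma compact_baire K (G : nat -> set Y) : compact K -> K !=set0 ->
  K `<=` \bigcup_n G n ->
  exists n u r, [/\ K u, 0 < r &
    forall v, K v -> mdist u v < r -> closure (G n `&` K) v].
Proof.
move=> cptK [u0 Ku0] KG; apply: contrapT => nodense.
(* Pairs (centre, radius): [Rel] says that the closed ball q lies in the
   closed ball p and misses the points of G n in K. *)
pose Inv (_ : nat) (p : Y * R) := K p.1 /\ 0 < p.2.
pose Rel n (p q : Y * R) := mdist p.1 q.1 + q.2 <= p.2 /\
  forall w, G n w -> K w -> q.2 < mdist q.1 w.
have [|n [u r] [/= Ku r0]|x xP] := @indexed_dependent_choice _ Inv Rel (u0, 1).
- by split=> //=.
- have [v [Kv uv ncl]] : exists v, [/\ K v, mdist u v < r &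
      ~ closure (G n `&` K) v].
    apply: contrapT => nov; apply: nodense; exists n, u, r; split=> // v Kv uv.
    by apply: contrapT => ncl; apply: nov; exists v.
  have [e e0 eG] : exists2 e, 0 < e & forall w, G n w -> K w -> e <= mdist v w.
    apply: contrapT => noe; apply: ncl; apply/closure_mdist => e e0.
    apply: contrapT => now; apply: noe; exists e => // w Gw Kw.
    by rewrite leNgt; apply/negP => vw; apply: now; exists w.
  have m0 : 0 < Num.min e (r - mdist u v) by rewrite lt_min e0 subr_gt0.
  exists (v, Num.min e (r - mdist u v) / 2); first by split=> //=; lra.
  have [me mr] : Num.min e (r - mdist u v) <= e /\
      Num.min e (r - mdist u v) <= r - mdist u v.
    by rewrite !ge_min !lexx orbT.
  split=> /= [|w Gw Kw]; first lra.
  by have := eG w Gw Kw; lra.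
have ball_le n m : mdist (x n).1 (x (n + m)%N).1 + (x (n + m)%N).2 <= (x n).2.
  elim: m => [|m IHm]; first by rewrite addn0 mdistxx add0r.
  rewrite addnS; have [_ [/= + _]] := xP (n + m)%N.
  have := metric_triangle (x n).1 (x (n + m)%N).1 (x (n + m).+1).1; lra.
have [|p [Kp clp]] := cptK ((fun n => (x n).1) @ \oo) _.
  by exists 0%N => // n _; have [[]] := xP n.
have [n _ Gp] := KG p Kp.
have [_ [_ /(_ p Gp Kp)]] := xP n; rewrite ltNge => /negP; apply.
apply/ler_addgt0Pr => e e0.
have [|_ [[m nm <-] /= pm]] := clp [set (x m).1 | m in [set m | (n < m)%N]] _ _
    (nbhs_mball p e0).
  by exists n.+1 => // m nm; exists m.
have := ball_le n.+1 (m - n.+1)%N; rewrite subnKC// => nmx.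
have := metric_triangle (x n.+1).1 (x m).1 p.
rewrite (metric_sym (x m).1 p); have [[_ /= xm0] _] := xP m; lra.
Qed.

End metric_topology.

Lemma invSn_lt (R : realType) (e : R) : 0 < e ->
  exists m : nat, m.+1%:R^-1 < e.
Proof.
move=> e0; have ie0 : 0 <= e^-1 by rewrite invr_ge0 ltW.
exists (Num.bound e^-1); rewrite -[ltRHS]invrK ltf_pV2 ?posrE ?invr_gt0//.
by rewrite (lt_le_trans (archi_boundP ie0))// ler_nat.
Qed.

(** * Fat points *)

Section fat_points.
Context {R : realType} {X Y : metricType R} (f : Y -> X) (t : R).
Implicit Types (y u v : Y) (e : R).

Definition fat_point y := forall e, 0 < e ->
  ~ premeasure_sigma_null t (f @` [set u | mdist y u < e]).

(** Lindelof: a thin point lies in a ball with sigma-null image, centred in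
    the countable dense set and of radius 1 / (m + 1); there are countably
    many such balls. *)
Lemma thin_points_sigma_null : separable Y ->
  premeasure_sigma_null t (f @` (~` fat_point)).
Proof.
move=> [D ctD denseD].
pose B (p : Y * nat) := [set u | mdist p.1 u < p.2.+1%:R^-1].
pose small := [set p | D p.1 /\ premeasure_sigma_null t (f @` B p)].
apply: (@premeasure_sigma_nullS _ _ _ _ (\bigcup_(p in small) (f @` B p))).
  move=> _ [y thiny <-].
  have [e e0 nulle] : exists2 e : R, 0 < e &
      premeasure_sigma_null t (f @` [set u | mdist y u < e]).
    apply: contrapT => noe; apply: thiny => e e0 nulle; apply: noe.
    by exists e.
  have [m me] := invSn_lt (divr_gt0 e0 (ltr0Sn R 1)).
  have m0 : 0 < m.+1%:R^-1 :> R by rewrite invr_gt0.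
  have [q [yq Dq]] : exists q, mdist y q < m.+1%:R^-1 /\ D q.
    have [||q [/interior_subset yq Dq]] :=
        denseD (interior [set u | mdist y u < m.+1%:R^-1]).
    - by exists y; exact: nbhs_mball.
    - exact: open_interior.
    - by exists q.
  exists (q, m); last by exists y => //; rewrite /B/= metric_sym.
  split=> //; apply: premeasure_sigma_nullS nulle; apply: image_subset => u.
  rewrite /B/= => qu; have := metric_triangle y q u.
  by move: me yq qu; move: (m.+1%:R^-1) => h; lra.
apply: premeasure_sigma_null_bigcup => [|p []//].
apply: (@sub_countable _ _ _ (D `*` setT)).
  by apply: subset_card_le => p [].
by apply: countableX.
Qed.

Hypothesis sepY : separable Y.

(** Removing the thin points from the ball changes its image by a sigma-null
    set only. *)
Lemma fat_points_near y e : fat_point y -> 0 < e ->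
  ~ premeasure_sigma_null t (f @` ([set u | mdist y u < e] `&` fat_point)).
Proof.
move=> faty e0 null; apply: (faty e e0).
pose E b := if b then f @` ([set u | mdist y u < e] `&` fat_point)
            else f @` (~` fat_point).
apply: (@premeasure_sigma_nullS _ _ _ _ (\bigcup_(b in [set: bool]) E b)).
  move=> _ [u yu <-]; have [fatu|thinu] := pselect (fat_point u).
    by exists true => //; exists u.
  by exists false => //; exists u.
apply: premeasure_sigma_null_bigcup; first exact: countableP.
by case=> _ //; exact: thin_points_sigma_null.
Qed.

Lemma fat_point_exists : ~ premeasure_sigma_null t (f @` [set: Y]) ->
  exists y, fat_point y.
Proof.
move=> nonnull; apply: contrapT => nofat; apply: nonnull.
apply: premeasure_sigma_nullS (thin_points_sigma_null sepY).
by apply: image_subset => y _ faty; apply: nofat; exists y.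
Qed.

End fat_points.

Lemma continuous_mdist (R : realType) (X Y : metricType R) (f : Y -> X) y
    (e : R) : continuous f -> 0 < e ->
  exists2 d, 0 < d & forall u, mdist y u <= d -> mdist (f y) (f u) <= e.
Proof.
move=> contf e0; have := contf y _ (nbhs_mball (f y) e0).
rewrite nbhs_simpl/= -metricType_numDomainType.filter_from_mdist_nbhs => -[d /= d0 df].
exists (d / 2); first by rewrite divr_gt0.
by move=> u yu; apply/ltW/df => /=; lra.
Qed.

(** * The tree of packings *)

Section construction.
Context {R : realType} {X Y : metricType R} (f : Y -> X) (s t : R).
Hypothesis contf : continuous f.
Hypothesis sepY : separable Y.
Hypothesis st : s < t.

(** One stage of the construction: [rad] is the radius, in Y, of the balls
    around the points of the stage in which everything later takes place, and
    [err] bounds the size of the images of these balls in X. *)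
Record net := Net { pts : seq Y ; rad : R ; err : R }.

Definition net_inv (n : nat) (N : net) : Prop :=
  [/\ (exists a, a \in pts N) /\ (forall a, a \in pts N -> fat_point f t a),
      0 < rad N /\ rad N <= n.+1%:R^-1, 0 < err N /\ err N <= n.+1%:R^-1,
      forall a u, a \in pts N -> mdist a u <= rad N ->
        mdist (f a) (f u) <= err N
    & forall a b, a \in pts N -> b \in pts N -> f a != f b ->
        4 * err N < mdist (f a) (f b)].

(** Three requirements: points are kept for ever; later balls shrink into
    earlier ones, the factor 2 leaving room for limit points; every point
    acquires a full packing inside its ball. *)
Definition net_step (n : nat) (N N' : net) : Prop :=
  [/\ {subset pts N <= pts N'},
      forall b, b \in pts N' ->
        exists2 a, a \in pts N & mdist a b + 2 * rad N' <= rad N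
    & forall a, a \in pts N -> exists (I : finType) (y : I -> Y) (r : I -> R),
        (forall i, y i \in pts N' /\ mdist a (y i) < rad N) /\
        full_packing s n.+1%:R^-1 setT (f \o y) r].

(** For a given finite set of fat points, [err] is chosen from the mutual
    distances of the images and then [rad] from the continuity of f and from
    the extra smallness requirement [P]. *)
Lemma net_of_points n (l : seq Y) : (exists a, a \in l) ->
  (forall a, a \in l -> fat_point f t a) -> forall P : Y -> R -> Prop,
  (forall a, a \in l ->
     exists2 e, 0 < e & forall e', 0 < e' -> e' <= e -> P a e') ->
  exists N, [/\ net_inv n N, pts N = l & forall a, a \in l -> P a (rad N)].
Proof.
move=> lnonempty lfat P Pl.
have n0 : 0 < n.+1%:R^-1 :> R by rewrite invr_gt0.
have [e1 e10 e1P] : exists2 e, 0 < e &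
    forall p e', p \in [seq (a, b) | a <- l, b <- l] -> 0 < e' -> e' <= e ->
      f p.1 != f p.2 -> 4 * e' < mdist (f p.1) (f p.2).
  apply: uniform_radius => -[a b] _ /=.
  have [_|fab] := eqVneq (f a) (f b); first by exists 1.
  exists (mdist (f a) (f b) / 5); first by rewrite divr_gt0// mdist_gt0.
  by move=> e' e'0 e'le _; move: fab; rewrite -mdist_gt0; lra.
pose d := Num.min e1 n.+1%:R^-1.
have d0 : 0 < d by rewrite lt_min e10.
have [e2 e20 e2P] : exists2 e, 0 < e & forall a e', a \in l -> 0 < e' ->
    e' <= e -> P a e' /\ forall u, mdist a u <= e' -> mdist (f a) (f u) <= d.
  apply: uniform_radius => a al; have [e e0 eP] := Pl a al.
  have [e' e'0 e'f] := continuous_mdist a contf d0.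
  exists (Num.min e e'); first by rewrite lt_min e0.
  move=> e'' e''0; rewrite le_min => /andP[ee ee']; split; first exact: eP.
  by move=> u au; apply: e'f; exact: le_trans ee'.
have m0 : 0 < Num.min e2 n.+1%:R^-1 by rewrite lt_min e20.
have me2 : Num.min e2 n.+1%:R^-1 <= e2 by rewrite ge_min lexx.
exists (Net l (Num.min e2 n.+1%:R^-1) d); split=> //=; last first.
  by move=> a al; have [] := e2P a _ al m0 me2.
split=> //=.
- by rewrite ge_min lexx orbT.
- by rewrite ge_min lexx orbT.
- by move=> a u al; have [_] := e2P a _ al m0 me2; apply.
- move=> a b al bl; apply: (e1P (a, b)) => //; first exact: allpairs_f.
  by rewrite ge_min lexx.
Qed.

Lemma net_inv0 : ~ premeasure_sigma_null t (f @` [set: Y]) ->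
  exists N, net_inv 0 N.
Proof.
move=> /(fat_point_exists sepY)[y faty].
have [|a|a _|N [N0 _ _]] := @net_of_points 0 [:: y] _ _ (fun _ _ => True).
- by exists y; rewrite mem_head.
- by rewrite inE => /eqP ->.
- by exists 1.
- by exists N.
Qed.

Lemma net_extend n N : net_inv n N -> exists2 N', net_inv n.+1 N' &
  net_step n N N'.
Proof.
move=> [[Nnonempty Nfat] [rad0 _] _ _ _].
have /choice[l lP] : forall a, exists l : seq Y, a \in pts N ->
    (forall b, b \in l -> fat_point f t b /\ mdist a b < rad N) /\
    exists (I : finType) (y : I -> Y) (r : I -> R),
      (forall i, y i \in l) /\ full_packing s n.+1%:R^-1 setT (f \o y) r.
  move=> a; have [aN|] := boolP (a \in pts N); last by exists [::].
  have /premeasure_gt0 /(packing_premeasure_gt0_full st) :=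
    fat_points_near sepY (Nfat a aN) rad0.
  move=> /(_ n.+1%:R^-1)[|I [x [r [[xE r0 sep] rle ge1]]]].
    by rewrite invr_gt0.
  have /choice[y yP] : forall i, exists u,
      [/\ mdist a u < rad N, fat_point f t u & f u = x i].
    by move=> i; have [u [au fatu] fu] := xE i; exists u.
  exists (codom y) => _; split=> [_ /codomP[i ->]|]; first by have [] := yP i.
  exists I, y, r; split=> [i|]; first exact: codom_f.
  have -> : f \o y = x by apply/funext => i /=; have [] := yP i.
  by split.
(* Keeping the old points makes the stages increase, so that each of their
   points belongs to the limit set; an old point is its own parent. *)
pose l' := pts N ++ flatten [seq l a | a <- pts N].
have l'P b : b \in l' -> fat_point f t b /\
    exists2 a, a \in pts N & mdist a b < rad N.
  rewrite mem_cat => /orP[bN|/flattenP[_ /mapP[a aN ->] bl]].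
    by split; [exact: Nfat|exists b; rewrite ?mdistxx].
  have [/(_ b bl)[fatb ab] _] := lP a aN.
  by split=> //; exists a.
have [|b bl'|b bl'|N' [N'inv N'l' N'P]] :=
  @net_of_points n.+1 l' _ _
    (fun b e => exists2 a, a \in pts N & mdist a b + 2 * e <= rad N).
- by have [a aN] := Nnonempty; exists a; rewrite /l' mem_cat aN.
- by have [] := l'P b bl'.
- have [_ [a aN ab]] := l'P b bl'.
  exists ((rad N - mdist a b) / 2); first by rewrite divr_gt0// subr_gt0.
  by move=> e' e'0 e'le; exists a => //; lra.
exists N' => //; split; rewrite ?N'l'//.
- by move=> a aN; rewrite mem_cat aN.
- move=> a aN; have [lfat [I [y [r [yl fullr]]]]] := lP a aN.
  exists I, y, r; split=> // i; have [_ ay] := lfat _ (yl i).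
  split=> //; rewrite mem_cat; apply/orP; right.
  by apply/flattenP; exists (l a) => //; exact: map_f.
Qed.

Lemma net_sequence : ~ premeasure_sigma_null t (f @` [set: Y]) ->
  exists N : nat -> net, forall n, net_inv n (N n) /\ net_step n (N n) (N n.+1).
Proof.
move=> /net_inv0[N0 N0inv].
exact: indexed_dependent_choice N0inv net_extend.
Qed.

End construction.

(** * The limit set *)

Section limit_set.
Context {R : realType} {X Y : metricType R} (f : Y -> X) (s t : R).
Hypothesis contf : continuous f.
Hypothesis complY : complete_space Y.
Variable N : nat -> @net R Y.
Hypothesis N_inv : forall n, net_inv f t n (N n).
Hypothesis N_step : forall n, net_step f s n (N n) (N n.+1).

Definition net_union := [set a | exists n, a \in pts (N n)].

Definition limit_set := closure net_union.

Lemma pts_sub n m a : (n <= m)%N -> a \in pts (N n) -> a \in pts (N m).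
Proof.
move=> nm; rewrite -(subnK nm); elim: (m - n)%N => // k IHk /IHk.
by have [sub _ _] := N_step (k + n); exact: sub.
Qed.

(** The balls around descendants are nested; this form of the estimate is
    closed under induction. *)
Lemma pts_ancestor n m b : (n <= m)%N -> b \in pts (N m) ->
  exists2 a, a \in pts (N n) & mdist a b + rad (N m) <= rad (N n).
Proof.
move=> nm; rewrite -(subnK nm); elim: (m - n)%N b => [|k IHk] b bN.
  by exists b => //; rewrite mdistxx add0r.
have [_ /(_ b bN)[c cN cb] _] := N_step (k + n).
have [a aN ac] := IHk c cN; exists a => //.
have [_ [rad0 _] _ _ _] := N_inv (k + n).+1.
rewrite addSn; have := metric_triangle a c b; lra.
Qed.

(** A limit point is approximated by a late descendant b; the ancestor c of b
    at stage n + 1 has a parent a at stage n, and the margin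
    [2 * rad (N n.+1)] between c and a absorbs both approximations. *)
Lemma limit_set_net n u : limit_set u ->
  exists2 a, a \in pts (N n) & mdist a u <= rad (N n).
Proof.
have [_ [rad0 _] _ _ _] := N_inv n.+1.
move=> /closure_mdist /(_ _ rad0)[b [m bm] ub].
have bM : b \in pts (N (maxn n.+1 m)) by apply: pts_sub bm; exact: leq_maxr.
have [c cN cb] := pts_ancestor (leq_maxl n.+1 m) bM.
have [_ /(_ c cN)[a aN ac] _] := N_step n.
have [_ [radM _] _ _ _] := N_inv (maxn n.+1 m).
exists a => //; have := metric_triangle a c b; have := metric_triangle a b u.
rewrite (metric_sym b u); lra.
Qed.

Lemma limit_set_compact : compact limit_set.
Proof.
apply: totally_bounded_compact => //; first exact: closed_closure.
move=> e e0; have [n ne] := invSn_lt e0; exists (pts (N n)) => u Ku.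
have [_ [_ radn] _ _ _] := N_inv n.
have [a aN au] := limit_set_net n Ku; exists a => //.
by rewrite (le_trans au)// (le_trans radn)// ltW.
Qed.

Lemma limit_set_nonempty : limit_set !=set0.
Proof.
have [[[a aN] _] _ _ _ _] := N_inv 0.
by exists a; apply: subset_closure; exists 0%N.
Qed.

Lemma image_limit_set_ultrametric : lipschitz_ultrametric (f @` limit_set).
Proof.
apply: finite_nets_lipschitz_ultrametric => e e0.
have [n ne] := invSn_lt e0.
have [_ _ [err0 errn] err_f err_sep] := N_inv n.
exists [set f a | a in [set a | a \in pts (N n)]], (err (N n)); split=> //.
- by rewrite (le_trans errn)// ltW.
- by move=> _ _ [a aN <-] [b bN <-]; exact: err_sep.
- move=> _ [u Ku <-]; have [a aN au] := limit_set_net n Ku.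
  by exists (f a); [exists a|exact: err_f].
Qed.

(** A net point a close to u keeps receiving full packings at all later
    stages n, with centres within [rad (N n)] of a, hence eventually in the
    portion; their images can be moved into F. *)
Lemma portion_everywhere_full u r (F : set X) : limit_set u -> 0 < r ->
  (forall v, limit_set v -> mdist u v < r ->
     closure (f @^-1` F `&` limit_set) v) ->
  everywhere_full s F.
Proof.
move=> Ku r0 dense_portion delta delta0.
have [a [m am] ua] := (closure_mdist _ _).1 Ku (r / 2) (divr_gt0 r0 (ltr0Sn R 1)).
have [k kr] := invSn_lt (divr_gt0 r0 (ltr0Sn R 1)).
have [l ldelta] := invSn_lt delta0.
(* late enough for a to be present, for its packing to stay in the portion,
   and for the radii to be at most delta *)
pose n := maxn m (maxn k l).
have inv_le (j : nat) : (j <= n)%N -> n.+1%:R^-1 <= j.+1%:R^-1 :> R.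
  by move=> jn; rewrite lef_pV2 ?posrE// ler_nat.
have kn : n.+1%:R^-1 <= k.+1%:R^-1 :> R.
  by apply: inv_le; rewrite /n !leq_max leqnn orbT.
have ln : n.+1%:R^-1 <= l.+1%:R^-1 :> R.
  by apply: inv_le; rewrite /n !leq_max leqnn !orbT.
have an : a \in pts (N n) by apply: pts_sub am; exact: leq_maxl.
have [_ _ /(_ a an)[I [y [q [yP [packq qle ge1]]]]]] := N_step n.
have [_ [_ radn] _ _ _] := N_inv n.
have [||x' fullx'] :=
    @full_packing_perturb _ _ s delta setT F I (f \o y) q.
- by split=> // i; rewrite (le_trans (qle i))// (le_trans ln)// ltW.
- move=> i e e0; have [yN ay] := yP i.
  have Kyi : limit_set (y i) by apply: subset_closure; exists n.+1.
  have uyi : mdist u (y i) < r.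
    have := metric_triangle u a (y i); have := le_lt_trans kn kr.
    move: radn ay; move: n.+1%:R^-1 => h; lra.
  have e2 : 0 < e / 2 by rewrite divr_gt0.
  have [d d0 dle] := continuous_mdist (y i) contf e2.
  have [w [Fw _] yw] := (closure_mdist _ _).1 (dense_portion _ Kyi uyi) d d0.
  exists (f w) => //=; have := dle w (ltW yw); lra.
- by exists I, x', q.
Qed.

Lemma packing_dim_image_limit_set : (s%:E <= packing_dim (f @` limit_set))%E.
Proof.
apply: packing_dim_ge => F KF.
have [|n [u [r [Ku r0 dense_portion]]]] := @compact_baire _ _ limit_set
    (fun n => f @^-1` F n) limit_set_compact limit_set_nonempty.
  by move=> u Ku; apply: KF; exists u.
by exists n; exact: portion_everywhere_full dense_portion.
Qed.

End limit_set.

Lemma lipschitz_ultrametric_subset (R : realType) (X : metricType R) (s : R) :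
  analytic X -> 0 < s -> (s%:E < packing_dim [set: X])%E ->
  exists S : set X,
    [/\ compact S, lipschitz_ultrametric S & (s%:E <= packing_dim S)%E].
Proof.
move=> [Y [f [sepY complY contf surjf]]] s0 sX.
(* t is the exponent whose sigma-null sets are discarded; the gap between s
   and t turns positive t-premeasure into s-mass at least 1 *)
have [t st tX] : exists2 t : R, s < t & (t%:E < packing_dim [set: X])%E.
  move: sX; case: (packing_dim _) => [d| |]//=.
    by rewrite lte_fin => sd; exists ((s + d) / 2); rewrite ?lte_fin; lra.
  by move=> _; exists (s + 1); rewrite ?ltry// ltrDl.
have nonnull : ~ premeasure_sigma_null t (f @` [set: Y]).
  move=> null; have t0 : 0 < t by exact: lt_trans st.
  suff : (packing_dim [set: X] <= t%:E)%E by rewrite leNgt tX.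
  exact/premeasure_sigma_null_dim/(premeasure_sigma_nullS surjf).
have [N NP] := net_sequence contf sepY st nonnull.
have Ninv n := (NP n).1; have Nstep n := (NP n).2.
exists (f @` limit_set N); split.
- apply: continuous_compact; first exact: continuous_subspaceT.
  exact: limit_set_compact Ninv Nstep.
- exact: image_limit_set_ultrametric Ninv Nstep.
- exact: packing_dim_image_limit_set Ninv Nstep.
Qed.

(* For packing_dim X = +oo the bound is read as "arbitrarily large": with
   +oo - delta = +oo it would fail, e.g. for the disjoint union of the cubes
   [0, 1]^n placed at mutual distance 1. *)
Theorem theorem3p1 (R : realType) (X : metricType R) (hX : analytic X) :
  ((packing_dim [set: X] < +oo)%E ->
     forall delta : R, 0 < delta ->
     exists S : set X,
       [/\ compact S, lipschitz_ultrametric S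
         & (packing_dim [set: X] - delta%:E <= packing_dim S)%E]) /\
  (packing_dim [set: X] = +oo%E ->
     forall M : R, exists S : set X,
       [/\ compact S, lipschitz_ultrametric S & (M%:E <= packing_dim S)%E]).
Proof.
split=> [dimX delta delta0|dimX M].
- have [d dE] : exists d : R, packing_dim [set: X] = d%:E.
    move: dimX (packing_dim_ge0 [set: X]); case: (packing_dim _) => // d _ _.
    by exists d.
  (* the construction needs a positive exponent; otherwise the empty set, of
     dimension 0, is large enough *)
  rewrite dE -EFinB; have [dlow|dhigh] := leP (d - delta) 0.
    exists set0; split; [exact: compact0|exact: lipschitz_ultrametric0|].
    by apply: le_trans (packing_dim_ge0 _); rewrite lee_fin.
  by apply: lipschitz_ultrametric_subset; rewrite ?dE ?lte_fin//; lra.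
- have M0 : 0 < Num.max M 1 by rewrite lt_max ltr01 orbT.
  have [|S [cptS ultraS dimS]] := lipschitz_ultrametric_subset hX M0.
    by rewrite dimX ltry.
  exists S; split=> //; apply: le_trans dimS.
  by rewrite lee_fin le_max lexx.
Qed.
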